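(* Let $\sigma\in(0,1)$ be any fixed constant. Then $$\lambda_\sigma>\frac{\sigma^2}{2}.$$
   Context: For $\lambda\in(0,\frac12)$ and $x\in\mathbb{R}$, $$\varphi_\lambda(x):=\int_0^{+\infty}y^{-2\lambda}\exp\left\{-\frac{(y-x)^2}{2}\right\}dy ,$$ and primes denote derivatives in $x$. For each $\lambda\in(0,\frac12)$, $x_1^\lambda<0$ denotes the unique negative number with $\varphi_\lambda''(x_1^\lambda)=0$, $z^\lambda>0$ denotes the unique positive number with $\varphi_\lambda''(z^\lambda)+\varphi_\lambda''(-z^\lambda)=0$ (existence and uniqueness hold), and $\sigma_\lambda:=-x_1^\lambda/z^\lambda\in(0,1)$. The map $\lambda\mapsto\sigma_\lambda$ is a continuous strictly increasing bijection from $(0,\frac12)$ onto $(0,1)$; for $\sigma\in(0,1)$, $\lambda_\sigma\in(0,\frac12)$ denotes the unique constant with $\sigma_{\lambda_\sigma}=\sigma$. *)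

(* Defs.v *)
From HB Require Import structures.
From mathcomp Require Import all_boot all_order all_algebra.
From mathcomp Require Import all_classical all_reals all_analysis.
Import Order.TTheory GRing.Theory Num.Theory.
Import numFieldNormedType.Exports.
Set Implicit Arguments.
Unset Strict Implicit.
Unset Printing Implicit Defensive.
Local Open Scope classical_set_scope.
Local Open Scope ring_scope.

Definition phi (R : realType) (lambda x : R) : R :=
  \int[lebesgue_measure]_(y in `]0, +oo[)
    (y `^ (- (2 * lambda)) * expR (- ((y - x) ^+ 2 / 2))).

(* On (0, 1/2), x_1^lambda is the unique x with is_x1 lambda x and z^lambda the
   unique z with is_z lambda z.  The predicates record the defining property
   only: a theorem about every such point applies to the unique one. *)
Definition is_x1 (R : realType) (lambda x : R) : Prop :=
  x < 0 /\ derive1n 2 (phi lambda) x = 0.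

Definition is_z (R : realType) (lambda z : R) : Prop :=
  0 < z /\ derive1n 2 (phi lambda) z + derive1n 2 (phi lambda) (- z) = 0.

Definition is_sigma (R : realType) (lambda sigma : R) : Prop :=
  exists x1 z : R, [/\ is_x1 lambda x1, is_z lambda z & sigma = - x1 / z].

(* lambda_sigma: the inverse of lambda |-> sigma_lambda, as a relation *)
Definition is_lambda (R : realType) (sigma lambda : R) : Prop :=
  0 < lambda < 1 / 2 /\ is_sigma lambda sigma.

(* Main.v *)
Require Import Defs.
From HB Require Import structures.
From mathcomp Require Import all_boot all_order all_algebra.
From mathcomp Require Import all_classical all_reals all_analysis.
From mathcomp Require Import measurable_realfun ring lra.
Import Order.TTheory GRing.Theory Num.Theory.
Import numFieldNormedType.Exports.
Local Open Scope classical_set_scope.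
Local Open Scope ring_scope.

(* Put p = -2 lambda and M q x = int_0^oo y^q exp (x y - y^2 / 2) dy, so that
   phi x = exp (- x^2 / 2) M p x. Since (M q)' = M (q + 1) and, integrating by
   parts, M (q + 2) x = x M (q + 1) x + (q + 1) M q x,
     phi'' x = exp (- x^2 / 2) ((x^2 - 2 lambda) M p x - x M (p + 1) x).
   As M > 0, a negative zero x1 of phi'' satisfies x1^2 < 2 lambda.
   With H x = M p x + M p (- x), the equation for z reads
   (z^2 - 2 lambda) H z = z H' z, while H' z >= (1 - 2 lambda) z H z; together
   they force z^2 >= 1. Hence sigma^2 = x1^2 / z^2 < 2 lambda. *)

(** * Improper integrals over the open half-line from a primitive *)

Section improper_integral.
Context {R : realType}.
Notation mu := (@lebesgue_measure R).
Variables (f F : R -> R).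
Hypothesis cf : {in `]0, +oo[, continuous f}.
Hypothesis dF : forall y : R, 0 < y -> is_derive y 1 F (f y).

(** Endpoints of compact intervals exhausting the open half-line. The upper one starts at 2, so that
    the interval is nondegenerate already at [n = 0], where the lower one is 1. *)
Let lo n : R := n.+1%:R^-1.
Let hi n : R := n.+2%:R.

Let lo_gt0 n : 0 < lo n. Proof. by rewrite invr_gt0 ltr0n. Qed.

Let lo_lt_hi n : lo n < hi n.
Proof.
by rewrite (@le_lt_trans _ _ 1) ?ltr1n// invf_le1 ?ltr0n// ler1n.
Qed.

Let sub_lo_hi n : `[lo n, hi n] `<=` `]0, +oo[.
Proof.
move=> y /=; rewrite !in_itv/= andbT => /andP[+ _].
exact: lt_le_trans.
Qed.

Let bigcup_lo_hi : \bigcup_n [set` `[lo n, hi n]] = `]0, +oo[%classic.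
Proof.
apply/seteqP; split; first by move=> y [n _]; exact: sub_lo_hi.
move=> y /=; rewrite in_itv/= andbT => y0.
exists (maxn (Num.truncn y) (Num.truncn y^-1)) => //=.
rewrite in_itv/=; apply/andP; split.
  rewrite /lo -[leRHS]invrK lef_pV2 ?posrE ?ltr0n ?invr_gt0//.
  apply: le_trans (ltW (truncnS_gt _)) _.
  by rewrite ler_nat ltnS leq_maxr.
apply: le_trans (ltW (truncnS_gt _)) _.
by rewrite ler_nat ltnS leqW// leq_maxl.
Qed.

Let lo_hi_homo m n : (m <= n)%N -> `[lo m, hi m] `<=` `[lo n, hi n].
Proof.
move=> mn; apply: subset_itv; rewrite bnd_simp.
  by rewrite lef_pV2 ?posrE ?ltr0n// ler_nat ltnS.
by rewrite ler_nat !ltnS.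
Qed.

Let nondecreasing_lo_hi :
  nondecreasing_seq (fun n => [set` `[lo n, hi n]]).
Proof. by move=> m n mn; apply/subsetPset; exact: lo_hi_homo. Qed.

Let measurable_primitive_deriv : measurable_fun (`]0, +oo[%classic : set R) f.
Proof.
apply: open_continuous_measurable_fun; first exact: interval_open.
by move=> y; rewrite inE; exact: cf.
Qed.

Let integral_lo_hi n :
  (\int[mu]_(y in `[lo n, hi n]) (f y)%:E = (F (hi n) - F (lo n))%:E)%E.
Proof.
have lo_hi_gt0 y : lo n <= y -> 0 < y by exact: lt_le_trans.
have cF y : lo n <= y -> {for y, continuous F}.
  move=> /lo_hi_gt0/dF dFy; apply/differentiable_continuous/derivable1_diffP.
  exact: ex_derive.
rewrite (@continuous_FTC2 _ f F)// ?EFinB//.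
- apply/continuous_in_subspaceT => y /[!inE]/= yn; apply: cf.
  exact: sub_lo_hi yn.
- split.
  + move=> y; rewrite in_itv/= => /andP[/ltW/lo_hi_gt0/dF dFy _].
    exact: ex_derive.
  + exact/cvg_at_right_filter/cF.
  + by apply/cvg_at_left_filter/cF; exact: ltW.
- move=> y; rewrite in_itv/= => /andP[/ltW/lo_hi_gt0/dF dFy _].
  by rewrite derive1E derive_val.
Qed.

(** Monotone convergence along the exhaustion: each partial integral is [F (hi n) - F (lo n)], hence
    at most [M]. *)
Lemma integrable_bounded_primitive (M : R) : (forall y, 0 < y -> 0 <= f y) ->
  (forall y, 0 < y -> 0 <= F y <= M) ->
  mu.-integrable `]0, +oo[ (EFin \o f).
Proof.
move=> f0 FM; apply/integrableP; split; first exact/measurable_EFinP.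
have -> : (\int[mu]_(y in `]0%R, +oo[) `|(EFin \o f) y| =
    \int[mu]_(y in `]0%R, +oo[) (f y)%:E)%E.
  apply: eq_integral => y; rewrite inE/= in_itv/= andbT => y0.
  by rewrite ger0_norm ?f0.
rewrite (@le_lt_trans _ _ M%:E) ?ltry//.
have /cvg_lim <- // : (\int[mu]_(y in `[lo n, hi n]) (f y)%:E @[n --> \oo] -->
    \int[mu]_(y in `]0%R, +oo[) (f y)%:E)%E.
  rewrite -bigcup_lo_hi; apply: ge0_nondecreasing_set_cvg_integral => //.
  - move=> n; apply/measurable_EFinP.
    exact: measurable_funS (@sub_lo_hi n) measurable_primitive_deriv.
  - move=> n y /sub_lo_hi/=; rewrite in_itv/= andbT lee_fin.
    exact: f0.
apply: lime_le.
  apply: ereal_nondecreasing_is_cvgn.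
  apply: ge0_nondecreasing_set_nondecreasing_integral => //.
  - move=> n; apply/measurable_EFinP.
    exact: measurable_funS (@sub_lo_hi n) measurable_primitive_deriv.
  - move=> n y /sub_lo_hi/=; rewrite in_itv/= andbT lee_fin.
    exact: f0.
apply: nearW => n; rewrite integral_lo_hi lee_fin.
have /andP[_ FhM] := FM _ (lt_trans (lo_gt0 n) (lo_lt_hi n)).
by have /andP[Fl0 _] := FM _ (lo_gt0 n); rewrite lerBlDr (le_trans FhM)// lerDl.
Qed.

(** Here [f] may change sign, so the exhaustion is passed to the limit by dominated convergence,
    with the absolute value of [f] as the dominating function. *)
Lemma Rintegral_primitive (l r : R) : mu.-integrable `]0, +oo[ (EFin \o f) ->
  F y @[y --> 0^'+] --> l -> F y @[y --> +oo] --> r ->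
  \int[mu]_(y in `]0, +oo[) f y = r - l.
Proof.
move=> intf Fl Fr.
have cvg_int : (\int[mu]_(y in `[lo n, hi n]) (f y)%:E @[n --> \oo] -->
    \int[mu]_(y in `]0%R, +oo[) (f y)%:E)%E.
  pose g n := (EFin \o f) \_ `[lo n, hi n].
  rewrite (_ : (fun n => _) = (fun n => \int[mu]_(y in `]0%R, +oo[) g n y)%E).
    apply: (@dominated_cvg _ _ _ mu _ _ _ _ (abse \o EFin \o f)) => //.
    - move=> n; apply/(measurable_restrict _ _ _) => //.
      apply/measurable_EFinP.
      exact: measurable_funS (@subIsetl _ _ _) measurable_primitive_deriv.
    (* The restrictions are eventually constant at [y]: once [y] lies in the [N]-th interval it lies
       in all later ones. *)
    - move=> y y0; rewrite -bigcup_lo_hi in y0; have [N _ yN] := y0.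
      apply: cvg_near_cst; near=> n.
      rewrite /g patchE mem_set//.
      by apply: lo_hi_homo yN; near: n; exact: nbhs_infty_ge.
    - exact: integrable_abse.
    - move=> n y y0; rewrite /g patchE; case: ifPn => // _.
      by rewrite [leLHS]abse0 abse_ge0.
  apply/funext => n; rewrite /g -integral_mkcondr.
  by congr (integral _ _ _); apply/esym/setIidr; exact: sub_lo_hi.
have : (F (hi n) - F (lo n))%:E @[n --> \oo] -->
    (\int[mu]_(y in `]0, +oo[) f y)%:E.
  rewrite fineK; last exact: integrable_fin_num.
  by move: cvg_int; under eq_fun do rewrite integral_lo_hi.
move=> /fine_cvg /= cvg_fine.
apply: (cvg_unique _ cvg_fine) => //=.
apply: cvgB.
- move/cvg_pinftyP : Fr; apply.
  suff -> : hi = (fun n => (n + 2)%:R).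
    by rewrite (cvg_shiftn 2 (fun n => n%:R : R)); exact: cvgr_idn.
  by apply/funext => n; rewrite addn2.
- move/cvg_at_rightP : Fl; apply; split => //.
  exact: cvg_harmonic.
Unshelve. all: end_near. Qed.

End improper_integral.

(** * Moments of the tilted Gaussian weight: integrability, derivative, positivity, recurrence *)

Section gauss_moment.
Context {R : realType}.
Notation mu := (@lebesgue_measure R).
Implicit Types p x y z : R.

Definition gauss_kernel p x y := y `^ p * expR (x * y - y ^+ 2 / 2).

Definition gauss_moment p x := \int[mu]_(y in `]0, +oo[) gauss_kernel p x y.

Lemma gauss_kernel_ge0 p x y : 0 <= gauss_kernel p x y.
Proof. by rewrite mulr_ge0 ?powR_ge0 ?expR_ge0. Qed.

Lemma gauss_kernel_gt0 p x y : 0 < y -> 0 < gauss_kernel p x y.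
Proof. by move=> y0; rewrite mulr_gt0 ?powR_gt0 ?expR_gt0. Qed.

Lemma gauss_kernelD1 p x y : 0 < y ->
  gauss_kernel (p + 1) x y = y * gauss_kernel p x y.
Proof.
move=> y0; rewrite /gauss_kernel powRD ?(gt_eqF y0) ?implybT// powRr1 ?ltW//.
by rewrite mulrCA mulrA.
Qed.

Lemma measurable_gauss_kernel p x : measurable_fun setT (gauss_kernel p x).
Proof.
apply: measurable_funM => //; apply: measurableT_comp => //.
apply: measurable_funB; first exact: measurable_funM.
by apply: measurable_funM => //; exact: measurable_funX.
Qed.

(** Raise [y <= expR y] to the power [p]. This absorbs a positive power into the linear term of the
    Gaussian exponent. *)
Lemma powR_le_expR p y : 0 <= p -> 0 < y -> y `^ p <= expR (p * y).
Proof.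
move=> p0 y0; rewrite mulrC expRM.
apply: ge0_ler_powR; rewrite ?nnegrE ?expR_ge0// ?ltW//.
by rewrite (lt_le_trans _ (expR_ge1Dx _))// ltrDr.
Qed.

Lemma is_derive_gauss_kernel_param p x y : 0 < y ->
  is_derive x 1 (gauss_kernel p ^~ y) (gauss_kernel (p + 1) x y).
Proof.
move=> y0; rewrite gauss_kernelD1//.
rewrite /gauss_kernel; apply: is_derive_eq.
rewrite /GRing.scale/=; ring.
Qed.

Lemma is_derive_gauss_kernel p x y : 0 < y ->
  is_derive y 1 (gauss_kernel (p + 1) x)
    ((p + 1) * gauss_kernel p x y + x * gauss_kernel (p + 1) x y
       - gauss_kernel (p + 1 + 1) x y).
Proof.
move=> y0; rewrite !gauss_kernelD1//.
rewrite /gauss_kernel; have dpow := is_derive1_powR (p + 1) y0.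
apply: is_derive_eq.
rewrite addrK powRD ?(gt_eqF y0) ?implybT// powRr1 ?ltW//.
rewrite /GRing.scale/=; by field.
Qed.

(** This is [y / (1 + y)], which maps the half-line into the unit interval; its powers supply
    bounded primitives. *)
Let base y := 1 - (1 + y)^-1.

Let base_gt0 y : 0 < y -> 0 < base y.
Proof. by move=> y0; rewrite subr_gt0 invf_lt1 ?ltrDl// addr_gt0. Qed.

Let base_lt1 y : 0 < y -> base y < 1.
Proof. by move=> y0; rewrite ltrBlDr ltrDl invr_gt0 addr_gt0. Qed.

Let base_le y : 0 < y -> base y <= y.
Proof.
move=> y0; have y1 : 0 < 1 + y by rewrite addr_gt0.
suff -> : base y = y / (1 + y) by rewrite ler_pdivrMr// ler_pMr// lerDl ltW.
by rewrite /base; field; rewrite gt_eqF.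
Qed.

Let is_derive_base_powR p y : 0 < y ->
  is_derive y 1 (fun y => base y `^ p) (p * base y `^ (p - 1) * (1 + y) ^- 2).
Proof.
move=> y0; have y1 : 1 + y != 0 by rewrite gt_eqF// addr_gt0.
have dbase : is_derive y 1 base ((1 + y) ^- 2).
  by apply: is_derive_eq; rewrite /GRing.scale/=; field.
exact: is_derive1_comp (is_derive1_powR p (base_gt0 _ y0)) dbase.
Qed.

(* The derivative of [(y / (1 + y)) `^ (p + 1) / (p + 1)]. *)
Let bound p y := base y `^ p * (1 + y) ^- 2.

(** The primitive takes values between 0 and [(p + 1)^-1]; the condition [-1 < p] makes the exponent
    [p + 1] positive. *)
Let integrable_bound p : -1 < p -> mu.-integrable `]0, +oo[ (EFin \o bound p).
Proof.
move=> p1; have q0 : 0 < p + 1 by rewrite -ltrBlDr sub0r.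
apply: (@integrable_bounded_primitive _ _
  (fun y => (p + 1)^-1 * base y `^ (p + 1)) _ _ (p + 1)^-1).
- move=> y; rewrite in_itv/= andbT => y0.
  have dpow := is_derive_base_powR p y y0.
  have y1 : (1 + y) ^+ 2 != 0 by rewrite gt_eqF// exprn_gt0// addr_gt0.
  apply/differentiable_continuous/derivable1_diffP/derivableM.
    exact: ex_derive.
  by apply: derivableV.
- move=> y y0; have dpow := is_derive_base_powR (p + 1) y y0.
  apply: is_derive_eq; rewrite /bound addrK /GRing.scale/=.
  by rewrite !mulrA mulVf ?mul1r// gt_eqF.
- move=> y y0.
  by rewrite mulr_ge0 ?powR_ge0 ?invr_ge0 ?exprn_ge0 ?addr_ge0 ?(ltW y0).
- move=> y y0; rewrite mulr_ge0 ?powR_ge0 ?invr_ge0 ?(ltW q0)//=.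
  rewrite ler_piMr ?invr_ge0 ?(ltW q0)//.
  apply: (@le_trans _ _ (1 `^ (p + 1))); last by rewrite powR1.
  by apply: ge0_ler_powR; rewrite ?nnegrE ?ltW ?base_gt0 ?base_lt1.
Qed.

(** A nonpositive power is antitone and [base y <= y], which handles the singularity at 0. The
    factor [(1 + y) ^+ 2] is at most [expR y ^+ 2], which replaces [x] by [x + 2] in the
    exponent. *)
Let gauss_kernel_le_bound p x y : p <= 0 -> 0 < y ->
  gauss_kernel p x y <= expR ((x + 2) ^+ 2 / 2) * bound p y.
Proof.
move=> p0 y0; have y1 : 0 < 1 + y by rewrite addr_gt0.
rewrite /gauss_kernel /bound mulrCA ler_pM ?powR_ge0 ?expR_ge0//.
  rewrite -[p]opprK [leLHS]powRN [leRHS]powRN.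
  rewrite lef_pV2 ?posrE ?powR_gt0// ?base_gt0//.
  apply: ge0_ler_powR; rewrite ?nnegrE ?oppr_ge0// ?(ltW y0)//.
    by rewrite ltW ?base_gt0.
  exact: base_le.
rewrite ler_pdivlMr ?exprn_gt0//.
apply: (@le_trans _ _ (expR (x * y - y ^+ 2 / 2) * expR y ^+ 2)).
  rewrite ler_wpM2l ?expR_ge0//.
  by rewrite ler_pXn2r ?nnegrE ?expR_ge0 ?(ltW y1)// expR_ge1Dx.
rewrite -expRM_natl -expRD ler_expR.
(* Completing the square: [(x + 2) * y - y ^+ 2 / 2] is at most [(x + 2) ^+ 2 / 2]. *)
have : 0 <= (y - (x + 2)) ^+ 2 by rewrite sqr_ge0.
nra.
Qed.

Lemma integrable_gauss_kernel p x : -1 < p ->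
  mu.-integrable `]0, +oo[ (EFin \o gauss_kernel p x).
Proof.
have mk q z :
    measurable_fun (`]0, +oo[%classic : set R) (EFin \o gauss_kernel q z).
  apply/measurable_EFinP.
  exact: measurable_funS (@subsetT _ _) (measurable_gauss_kernel q z).
(* A positive exponent [p] reduces to exponent 0: the power is at most [expR (p * y)], which shifts
   the parameter from [x] to [x + p]. *)
wlog p0 : p x / p <= 0 => [nonpos p1|p1].
  have [p0|p0] := leP p 0; first exact: nonpos.
  have i0 : mu.-integrable `]0, +oo[ (EFin \o gauss_kernel 0 (x + p)).
    by apply: nonpos; rewrite ?ltrN10.
  apply: le_integrable i0 => // [|y /=]; first exact: mk.
  rewrite in_itv/= andbT => y0.
  rewrite lee_fin !ger0_norm ?gauss_kernel_ge0//.
  rewrite /gauss_kernel powRr0 mul1r mulrDl -addrA [p * y + _]addrC addrA.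
  rewrite [leRHS]expRD mulrC ler_wpM2l ?expR_ge0//.
  by apply: powR_le_expR => //; exact: ltW.
have ibound : mu.-integrable `]0, +oo[
    (fun y => (expR ((x + 2) ^+ 2 / 2))%:E * (bound p y)%:E)%E.
  by apply: integrableZl => //; exact: integrable_bound.
apply: le_integrable ibound => // [|y /=]; first exact: mk.
rewrite in_itv/= andbT => y0.
rewrite lee_fin !ger0_norm ?gauss_kernel_ge0//.
  exact: gauss_kernel_le_bound.
by apply: le_trans (gauss_kernel_le_bound p x y p0 y0); exact: gauss_kernel_ge0.
Qed.

(** Differentiation under the integral sign on the unit neighbourhood of [x]. For [y > 0] the kernel
    increases with its parameter, so its value at [x + 1] dominates the derivatives there. *)
Lemma is_derive_gauss_moment p x : -1 < p ->
  is_derive x 1 (gauss_moment p) (gauss_moment (p + 1) x).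
Proof.
move=> p1; have p2 : -1 < p + 1 by rewrite ltr_wpDr.
have xI : [set` `](x - 1), (x + 1)[] x.
  by rewrite /= in_itv/= ltrDl ltr01 ltrBlDr ltrDl ltr01.
have intk z : [set` `](x - 1), (x + 1)[] z ->
    mu.-integrable `]0, +oo[ (EFin \o gauss_kernel p z).
  by move=> _; exact: integrable_gauss_kernel.
have dk z y : [set` `](x - 1), (x + 1)[] z -> [set` `]0, +oo[] y ->
    derivable (gauss_kernel p ^~ y) z 1.
  move=> _; rewrite /= in_itv/= andbT => y0.
  have dky := is_derive_gauss_kernel_param p z y y0; exact: ex_derive.
have partialE z y : 0 < y ->
    partial1of2 (gauss_kernel p) z y = gauss_kernel (p + 1) z y.
  move=> y0; have dky := is_derive_gauss_kernel_param p z y y0.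
  by rewrite partial1of2E derive_val.
have ub z y : [set` `](x - 1), (x + 1)[] z -> [set` `]0, +oo[] y ->
    `|partial1of2 (gauss_kernel p) z y| <= gauss_kernel (p + 1) (x + 1) y.
  rewrite /= !in_itv/= andbT => /andP[_ zx] y0.
  rewrite partialE// ger0_norm ?gauss_kernel_ge0//.
  by rewrite ler_wpM2l ?powR_ge0// ler_expR lerD2r ler_wpM2r ?(ltW y0) ?(ltW zx).
have G0 := gauss_kernel_ge0 (p + 1) (x + 1).
have intG := integrable_gauss_kernel (p + 1) (x + 1) p2.
apply: DeriveDef.
  by apply: (derivable_under_integral _ xI intk dk G0 intG ub).
rewrite -derive1E (differentiation_under_integral _ xI intk dk G0 intG ub)//.
by apply: eq_Rintegral => y; rewrite inE/= in_itv/= andbT => y0; rewrite partialE.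
Qed.

(** A zero integral would make the positive kernel vanish almost everywhere, so a null set would
    contain the unit interval. *)
Lemma gauss_moment_gt0 p x : -1 < p -> 0 < gauss_moment p x.
Proof.
move=> p1; have intk := integrable_gauss_kernel p x p1.
have mD : measurable (`]0, +oo[%classic : set R) by [].
rewrite lt_neqAle; apply/andP; split; last first.
  by apply: Rintegral_ge0 => y _; exact: gauss_kernel_ge0.
apply/eqP => int0.
have : (\int[mu]_(y in `]0%R, +oo[) `|(EFin \o gauss_kernel p x) y| = 0)%E.
  rewrite [RHS](congr1 EFin int0) fineK ?integrable_fin_num//.
  by apply: eq_integral => y _ /=; rewrite ger0_norm ?gauss_kernel_ge0.
have /iffLR /[apply] := ae_eq_integral_abs mu mD (measurable_int _ intk).
move=> [N [mN muN0 /= subN]].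
have : (mu `]0%R, 1%R[%classic <= mu N)%E.
  apply: le_measure; rewrite ?inE//.
  apply: subset_trans subN => y; rewrite /= in_itv/= => /andP[y0 _].
  apply/not_implyP; split; first by rewrite in_itv/= y0.
  by move=> [k0]; move: (gauss_kernel_gt0 p x y y0); rewrite k0 ltxx.
by rewrite muN0 lebesgue_measure_itv/= lte_fin ltr01 oppr0 adde0 lee_fin ler10.
Qed.

(** Completing the square again: in [x + p + 1], the [p] comes from bounding the power by an
    exponential and the 1 pays for the decaying factor [expR (- y)]. *)
Let kernel_tail p x y : 0 <= p -> 0 < y ->
  gauss_kernel p x y <= expR ((x + p + 1) ^+ 2 / 2) * expR (- y).
Proof.
move=> p0 y0.
apply: (@le_trans _ _ (expR (p * y) * expR (x * y - y ^+ 2 / 2))).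
  by rewrite ler_wpM2r ?expR_ge0// powR_le_expR.
rewrite -!expRD ler_expR.
have : 0 <= (y - (x + p + 1)) ^+ 2 by rewrite sqr_ge0.
nra.
Qed.

(* The derivative of [gauss_kernel (p + 1) x], which vanishes at 0 and +oo,
   integrates to 0. *)
Lemma gauss_moment_rec p x : -1 < p ->
  gauss_moment (p + 1 + 1) x =
  x * gauss_moment (p + 1) x + (p + 1) * gauss_moment p x.
Proof.
move=> p1; have q0 : 0 < p + 1 by rewrite -ltrBlDr sub0r.
have p2 : -1 < p + 1 by rewrite ltr_wpDr.
have p3 : -1 < p + 1 + 1 by rewrite ltr_wpDr.
have mD : measurable (`]0, +oo[%classic : set R) by [].
have i0 := integrable_gauss_kernel p x p1.
have i1 := integrable_gauss_kernel (p + 1) x p2.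
have i2 := integrable_gauss_kernel (p + 1 + 1) x p3.
have ip : mu.-integrable `]0, +oo[
    (EFin \o (fun y => (p + 1) * gauss_kernel p x y)).
  by apply: (integrableZl _ (p + 1) i0).
have ix : mu.-integrable `]0, +oo[
    (EFin \o (fun y => x * gauss_kernel (p + 1) x y)).
  by apply: (integrableZl _ x i1).
have ipx : mu.-integrable `]0, +oo[ (EFin \o
    (fun y => (p + 1) * gauss_kernel p x y + x * gauss_kernel (p + 1) x y)).
  by apply: (integrableD _ ip ix).
have intf : mu.-integrable `]0, +oo[ (EFin \o
    (fun y => (p + 1) * gauss_kernel p x y + x * gauss_kernel (p + 1) x y
       - gauss_kernel (p + 1 + 1) x y)).
  by apply: (integrableB _ ipx i2).
(* The right-hand side is kept as [0 - 0]: the limit at infinity minus the limit at 0. *)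
suff : \int[mu]_(y in `]0, +oo[)
    ((p + 1) * gauss_kernel p x y + x * gauss_kernel (p + 1) x y
       - gauss_kernel (p + 1 + 1) x y) = 0 - 0.
  rewrite RintegralB// RintegralD// !RintegralZl// subr0 => /subr0_eq/esym.
  by rewrite [X in _ = X -> _]addrC.
apply: (@Rintegral_primitive _ _ (gauss_kernel (p + 1) x)) => //.
- move=> y; rewrite in_itv/= andbT => y0.
  have ck q : {for y, continuous (gauss_kernel q x)}.
    have := is_derive_gauss_kernel (q - 1) x y y0; rewrite subrK => dk.
    by apply/differentiable_continuous/derivable1_diffP; exact: ex_derive.
  apply: cvgB; last exact: ck.
  by apply: cvgD; apply: cvgM; try exact: ck; exact: cvg_cst.
- exact: is_derive_gauss_kernel.
- rewrite -[X in _ --> X](mul0r (expR (x * 0 - 0 ^+ 2 / 2))); apply: cvgM.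
    exact: powR_cvg0.
  apply: cvg_at_right_filter.
  suff : {for 0, continuous (fun y => expR (x * y - y ^+ 2 / 2))} by [].
  by apply/differentiable_continuous/derivable1_diffP; exact: ex_derive.
- apply: (@squeeze_cvgr _ _ _ _ (cst 0)
    (fun y => expR ((x + (p + 1) + 1) ^+ 2 / 2) * expR (- y))).
  + near=> y; rewrite /= gauss_kernel_ge0/= kernel_tail// ltW//.
  + exact: cvg_cst.
  + rewrite -[X in _ --> X](mulr0 (expR ((x + (p + 1) + 1) ^+ 2 / 2))).
    by apply: cvgM; [exact: cvg_cst|exact: cvgr_expR].
Unshelve. all: end_near. Qed.

Lemma le_gauss_moment p : -1 < p -> {homo gauss_moment p : x y / x <= y}.
Proof.
move=> p1 x y xy; apply: le_Rintegral => //; try exact: integrable_gauss_kernel.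
move=> z; rewrite /= in_itv/= andbT => z0.
by rewrite ler_wpM2l ?powR_ge0// ler_expR lerD2r ler_wpM2r// ltW.
Qed.

End gauss_moment.

(** * Derivatives of [phi] in terms of moments, and the symmetrised inequality *)

Section phi_moment.
Context {R : realType}.
Implicit Types p x y z lambda : R.

Lemma phi_gauss_moment lambda : lambda < 1 / 2 ->
  phi lambda = fun x => expR (- (x ^+ 2 / 2)) * gauss_moment (- (2 * lambda)) x.
Proof.
move=> l2; apply/funext => x; rewrite -RintegralZl//.
  apply: eq_Rintegral => y _; rewrite /gauss_kernel mulrCA -expRD.
  by congr (_ * expR _); field.
apply: integrable_gauss_kernel; lra.
Qed.

Let is_derive_gauss_momentN p x : -1 < p ->
  is_derive x 1 (fun t => gauss_moment p (- t)) (- gauss_moment (p + 1) (- x)).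
Proof.
move=> p1; have dM := is_derive_gauss_moment p (- x) p1.
have dN : is_derive x 1 (-%R : R -> R) (-1) by apply: is_derive_eq.
by apply: is_derive_eq (is_derive1_comp dM dN) _; rewrite mulrN1.
Qed.

(* With [H x := M p x + M p (- x)], the recurrence says [H'' = x H' + (p + 1) H],
   hence [(H' - (p + 1) x H)' = - p x H'], which is nonnegative. *)
Lemma gauss_moment_sym_le p x : -1 < p -> p <= 0 -> 0 <= x ->
  (p + 1) * x * (gauss_moment p x + gauss_moment p (- x)) <=
  gauss_moment (p + 1) x - gauss_moment (p + 1) (- x).
Proof.
move=> p1 p0 x0; have p2 : -1 < p + 1 by rewrite ltr_wpDr.
pose D t := gauss_moment (p + 1) t - gauss_moment (p + 1) (- t)
  - (p + 1) * t * (gauss_moment p t + gauss_moment p (- t)).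
have dD (t : R) : is_derive t 1 D
    (- p * t * (gauss_moment (p + 1) t - gauss_moment (p + 1) (- t))).
  have d0 := is_derive_gauss_moment p t p1.
  have d1 := is_derive_gauss_moment (p + 1) t p2.
  have d0N := is_derive_gauss_momentN p t p1.
  have d1N := is_derive_gauss_momentN (p + 1) t p2.
  rewrite /D; apply: is_derive_eq.
  rewrite /GRing.scale/= (gauss_moment_rec p t)// (gauss_moment_rec p (- t))//.
  move: (gauss_moment (p + 1)) (gauss_moment p) => M1 M0; ring.
(* It remains to see that [D] starts from 0 and is nondecreasing: [- p * t] is nonnegative, and so
   is the moment difference because moments increase with their parameter. *)
rewrite -subr_ge0 -/(D x).
have <- : D 0 = 0 by rewrite /D oppr0 subrr mulr0 mul0r subrr.
apply: (@ger0_derive1_ndecr _ D 0 x) => // [t|].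
- rewrite in_itv/= => /andP[t0 _]; rewrite derive1E derive_val.
  rewrite mulr_ge0// ?mulr_ge0 ?oppr_ge0 ?(ltW t0)// subr_ge0 le_gauss_moment//.
  by rewrite ge0_cp// ltW.
- by apply: derivable_within_continuous => t _; exact: ex_derive.
Qed.

(** Write [M q] for [gauss_moment q] and [p] for [- (2 * lambda)]. Two differentiations give the
    bracket [M (p + 2) x - 2 x M (p + 1) x + (x^2 - 1) M p x]; the recurrence eliminates
    [M (p + 2)]. *)
Lemma phi_derive2 lambda x : lambda < 1 / 2 ->
  derive1n 2 (phi lambda) x =
  expR (- (x ^+ 2 / 2)) *
    ((x ^+ 2 - 2 * lambda) * gauss_moment (- (2 * lambda)) x
     - x * gauss_moment (- (2 * lambda) + 1) x).
Proof.
move=> l2; have p1 : -1 < - (2 * lambda) by lra.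
have p2 : -1 < - (2 * lambda) + 1 by rewrite ltr_wpDr.
rewrite phi_gauss_moment// derive1nS derive1n1.
have -> : derive1
      (fun t => expR (- (t ^+ 2 / 2)) * gauss_moment (- (2 * lambda)) t) =
    (fun t => expR (- (t ^+ 2 / 2)) * (gauss_moment (- (2 * lambda) + 1) t
       - t * gauss_moment (- (2 * lambda)) t)).
  apply/funext => t; have d0 := is_derive_gauss_moment _ t p1.
  rewrite derive1E derive_val /GRing.scale/=.
  by move: (gauss_moment (_ + 1)) (gauss_moment (- _)) => M1 M0; field.
have d0 := is_derive_gauss_moment _ x p1.
have d1 := is_derive_gauss_moment _ x p2.
rewrite derive1E derive_val /GRing.scale/= gauss_moment_rec//.
by move: (gauss_moment (_ + 1)) (gauss_moment (- _)) => M1 M0; field.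
Qed.

End phi_moment.

(** * Bounds on the two zeros and on their quotient *)

Theorem proposition3p18 (R : realType) (sigma : R) (hsigma : 0 < sigma < 1)
    (lambda : R) (hlambda : is_lambda sigma lambda) :
  lambda > sigma ^+ 2 / 2.
Proof.
case: hlambda => /andP[l0 l2] sigmaP.
pose p := - (2 * lambda).
have [p1 p0] : -1 < p /\ p <= 0 by rewrite /p; split; lra.
case: sigmaP => x [z [[x0 phix] [z0 phiz] ->]].
have p2 : -1 < p + 1 by rewrite ltr_wpDr.
have x_lt : x ^+ 2 < 2 * lambda.
  move/eqP : phix; rewrite (phi_derive2 _ x)// mulf_eq0 gt_eqF ?expR_gt0//=.
  rewrite subr_eq0 -/p => /eqP phix.
  have : (x ^+ 2 - 2 * lambda) * gauss_moment p x < 0.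
    by rewrite phix nmulr_rlt0// gauss_moment_gt0.
  by rewrite pmulr_llt0 ?gauss_moment_gt0// subr_lt0.
have z_ge1 : 1 <= z ^+ 2.
  have /(ler_wpM2l (ltW z0)) := gauss_moment_sym_le p z p1 p0 (ltW z0).
  set H := gauss_moment p z + gauss_moment p (- z) => le_H.
  have H0 : 0 < H by rewrite addr_gt0 ?gauss_moment_gt0.
  move: phiz; rewrite (phi_derive2 _ z)// (phi_derive2 _ (- z))// sqrrN -mulrDr.
  move/eqP; rewrite mulf_eq0 gt_eqF ?expR_gt0//= -/p => /eqP phiz.
  (* The equation for [z] turns [le_H] into [(1 - 2 lambda) z^2 H <= (z^2 - 2 lambda) H]; the
     difference of the two sides is the product claimed nonnegative. *)
  have : 0 <= (2 * lambda * (z ^+ 2 - 1)) * H.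
    move: le_H phiz; rewrite /H /p.
    move: (gauss_moment _ z) (gauss_moment _ (- z)) => a b.
    move: (gauss_moment _ z) (gauss_moment _ (- z)) => A B.
    clear; lra.
  by rewrite pmulr_lge0// pmulr_rge0 ?mulr_gt0// subr_ge0.
have z2 : 0 < z ^+ 2 by rewrite exprn_gt0.
(* Clearing denominators leaves [x^2 < 2 lambda z^2], which follows from [x^2 < 2 lambda] and
   [1 <= z^2]. *)
rewrite ltr_pdivrMr// expr_div_n sqrrN ltr_pdivrMr// [lambda * 2]mulrC.
by apply: lt_le_trans x_lt _; rewrite ler_peMr// mulr_ge0// ltW.
Qed.
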